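(* Consider the two-dimensional Maxwell--Debye scheme of Joseph et al. with equal space steps $\delta x=\delta y>0$, in either of the polarisations $(B_x,B_y,E_z)$ or $(B_z,E_x,E_y)$, with $c_\infty,\epsilon_\infty,t_r,\delta t>0$ and $\epsilon_s\ge\epsilon_\infty$. In both polarisations the scheme is stable under the following condition: (i) if $\epsilon_s>\epsilon_\infty$: $\ \delta t\le\dfrac{\delta x}{\sqrt2\,c_\infty}$; (ii) if $\epsilon_s=\epsilon_\infty$: $\ \delta t<\dfrac{\delta x}{\sqrt2\,c_\infty}$.
   Context: Put $\lambda=c_\infty\delta t/\delta x$, $\delta=\delta t/(2t_r)$, $\epsilon_s'=\epsilon_s/\epsilon_\infty$ and, for $\xi=(\xi_x,\xi_y)\in\mathbb R^2$, $\sigma_x=\lambda(e^{i\xi_x}-1)$, $\sigma_y=\lambda(e^{i\xi_y}-1)$; a star denotes complex conjugation. Here $c_\infty$ is the light speed at infinite frequency. The scheme is the Yee (staggered leap-frog) discretization of Maxwell's equations closed by the Debye law $(e^{n+1}-e^n)+\delta\epsilon_s'(e^{n+1}+e^n)=(d^{n+1}-d^n)+\delta(d^{n+1}+d^n)$ for each electric component, where $b=c_\infty B$, $e=E$, $d=D/(\epsilon_0\epsilon_\infty)$. For plane waves $e^{i(\xi_xj+\xi_yk)}$ (with $B$ components at time $n-\frac12$, and $E,D$ at time $n$) the amplitudes evolve by one step, old values without and new values with a superscript $+$, as follows. Polarisation $(B_x,B_y,E_z)$, state $(b_x,b_y,e,d)\in\mathbb C^4$: $b_x^+=b_x-\sigma_ye$,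 $b_y^+=b_y+\sigma_xe$, $r=\sigma_y^*b_x^+-\sigma_x^*b_y^+$, and then $d^+=d+r$, $(1+\delta\epsilon_s')e^+=(1-\delta\epsilon_s')e+(1+\delta)d^+-(1-\delta)d$. Polarisation $(B_z,E_x,E_y)$, state $(b,e_x,d_x,e_y,d_y)\in\mathbb C^5$: $b^+=b+\sigma_ye_x-\sigma_xe_y$, $r_x=-\sigma_y^*b^+$, $r_y=\sigma_x^*b^+$, and then for each $a\in\{x,y\}$: $d_a^+=d_a+r_a$, $(1+\delta\epsilon_s')e_a^+=(1-\delta\epsilon_s')e_a+(1+\delta)d_a^+-(1-\delta)d_a$. In each polarisation, $G(\xi)$ denotes the matrix of the linear map from old to new state (the amplification matrix). Stability (in the sense of von Neumann) means: for every $\xi\in\mathbb R^2$, the sequence of powers $(G(\xi)^n)_{n\ge0}$ is bounded. *)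

(* Defs.v *)
From mathcomp Require Export all_boot all_order all_algebra.
From mathcomp Require Export complex.
From mathcomp Require Export reals trigo.
From mathcomp Require Import ring.
Set Implicit Arguments.
Unset Strict Implicit.
Unset Printing Implicit Defensive.
Import Order.TTheory GRing.Theory Num.Theory.
Local Open Scope ring_scope.
Local Open Scope complex_scope.

Definition cexpi {R : realType} (t : R) : R[i] := cos t +i* sin t.

Definition sigma {R : realType} (lambda t : R) : R[i] :=
  lambda%:C * (cexpi t - 1).

(* The new electric amplitude, from the old amplitudes e, d and the new
   amplitude dp of the displacement; see debye_stepP for the Debye law. *)
Definition debye_step {R : realType} (delta epsp : R) (e d dp : R[i]) : R[i] :=
  ((1 - delta * epsp)%:C * e + (1 + delta)%:C * dp - (1 - delta)%:C * d)
    / (1 + delta * epsp)%:C.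

(* The state is the column (b_x, b_y, e, d). *)
Definition step_BxByEz {R : realType} (lambda delta epsp xi_x xi_y : R)
    (U : 'cV[R[i]]_4) : 'cV[R[i]]_4 :=
  let sx := sigma lambda xi_x in let sy := sigma lambda xi_y in
  let bx := U 0 0 in let by_ := U 1 0 in
  let e := U 2%:R 0 in let d := U 3%:R 0 in
  let bxp := bx - sy * e in
  let byp := by_ + sx * e in
  let r := sy^* * bxp - sx^* * byp in
  let dp := d + r in
  let ep := debye_step delta epsp e d dp in
  \col_(i < 4) [:: bxp; byp; ep; dp]`_i.

(* The state is the column (b, e_x, d_x, e_y, d_y). *)
Definition step_BzExEy {R : realType} (lambda delta epsp xi_x xi_y : R)
    (U : 'cV[R[i]]_5) : 'cV[R[i]]_5 :=
  let sx := sigma lambda xi_x in let sy := sigma lambda xi_y in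
  let b := U 0 0 in
  let ex := U 1 0 in let dx := U 2%:R 0 in
  let ey := U 3%:R 0 in let dy := U 4%:R 0 in
  let bp := b + sy * ex - sx * ey in
  let rx := - sy^* * bp in
  let ry := sx^* * bp in
  let dxp := dx + rx in
  let dyp := dy + ry in
  let exp := debye_step delta epsp ex dx dxp in
  let eyp := debye_step delta epsp ey dy dyp in
  \col_(i < 5) [:: bp; exp; dxp; eyp; dyp]`_i.

(* Matrix of a linear map acting on columns (lin1_mx is for maps on rows). *)
Definition matrix_of_map {K : pzRingType} {n : nat}
    (f : 'cV[K]_n -> 'cV[K]_n) : 'M[K]_n :=
  \matrix_(i, j) f (delta_mx j 0) i 0.

Definition von_neumann_stable {R : realType} {n : nat}
    (G : R -> R -> 'M[R[i]]_n.+1) : Prop :=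
  forall xi_x xi_y : R, exists M : R, forall (k : nat) (i j : 'I_n.+1),
    `|(G xi_x xi_y ^+ k) i j| <= M%:C.

(* Physical parameters: light speed c_inf and relative permittivity eps_inf at
   infinite frequency, static relative permittivity eps_s, relaxation time t_r,
   common space step dx (= dy), time step dt. *)
Definition amplification_BxByEz {R : realType}
    (c_inf eps_inf eps_s t_r dx dt xi_x xi_y : R) : 'M[R[i]]_4 :=
  matrix_of_map (step_BxByEz (c_inf * dt / dx) (dt / (2 * t_r))
                             (eps_s / eps_inf) xi_x xi_y).

Definition amplification_BzExEy {R : realType}
    (c_inf eps_inf eps_s t_r dx dt xi_x xi_y : R) : 'M[R[i]]_5 :=
  matrix_of_map (step_BzExEy (c_inf * dt / dx) (dt / (2 * t_r))
                             (eps_s / eps_inf) xi_x xi_y).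

Lemma debye_stepP (R : realType) (delta epsp : R) (e d dp : R[i]) :
  1 + delta * epsp != 0 ->
  let ep := debye_step delta epsp e d dp in
  (ep - e) + (delta * epsp)%:C * (ep + e) = (dp - d) + delta%:C * (dp + d).
Proof.
move=> nz /=.
have nzC : (1 + delta * epsp)%:C != 0 :> R[i].
  by rewrite -(rmorph0 (real_complex R)) (inj_eq (@complexI R)).
set ep := debye_step _ _ _ _ _.
have H : (1 + delta * epsp)%:C * ep =
  (1 - delta * epsp)%:C * e + (1 + delta)%:C * dp - (1 - delta)%:C * d.
  by rewrite /ep /debye_step mulrCA divff ?mulr1.
move: H; rewrite !(rmorphD, rmorphB) /= rmorph1.
set a := (delta * epsp)%:C; set b := delta%:C => H.
have -> : ep - e + a * (ep + e) = (1 + a) * ep - (1 - a) * e by ring.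
by rewrite H; ring.
Qed.

Lemma matrix_of_mapP (K : comPzRingType) (n : nat) (f : 'cV[K]_n -> 'cV[K]_n) :
  linear f -> forall U, matrix_of_map f *m U = f U.
Proof.
move=> lf U.
have f0 : f 0 = 0 by have := lf (-1) 0 0; rewrite !scaleN1r oppr0 !addr0 addNr.
have fD u v : f (u + v) = f u + f v by have := lf 1 u v; rewrite !scale1r.
have fZ a u : f (a *: u) = a *: f u by have := lf a u 0; rewrite f0 !addr0.
rewrite [in RHS](matrix_sum_delta U) (big_morph f fD f0).
apply/colP => i; rewrite !mxE summxE; apply: eq_bigr => j _.
by rewrite big_ord1 fZ !mxE mulrC.
Qed.

Lemma step_BxByEz_linear (R : realType) (lambda delta epsp xi_x xi_y : R) :
  linear (step_BxByEz lambda delta epsp xi_x xi_y).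
Proof.
move=> a U V; apply/colP => -[[|[|[|[|//]]]] lt4];
  rewrite /step_BxByEz /debye_step !mxE /=; ring.
Qed.

Lemma step_BzExEy_linear (R : realType) (lambda delta epsp xi_x xi_y : R) :
  linear (step_BzExEy lambda delta epsp xi_x xi_y).
Proof.
move=> a U V; apply/colP => -[[|[|[|[|[|//]]]]] lt5];
  rewrite /step_BzExEy /debye_step !mxE /=; ring.
Qed.

(* Main.v *)
(* In Fourier space both polarisations split into explicitly solvable parts and
   one 3-dimensional recurrence with real coefficients for a magnetic amplitude
   [b], an electric amplitude [e] and its displacement [d], in which the Yee
   operator enters only through [q = |sigma_x|^2 + |sigma_y|^2 <= 8 lambda^2].
   With [p = d - e] and [alpha = delta (eps_s' - 1)], the energy
   [e^2 - b e + b^2 / q + (delta / alpha) p^2] decreases by [(p^+ - p)^2 / alpha]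
   at each step. It is positive definite when [q < 4] and [alpha > 0]. If
   [alpha = 0] then [p] decays by itself and can be decoupled; if [q = 4] the
   energy degenerates, but a further linear form changes sign at each step. *)

Require Import Defs.
From mathcomp Require Import all_boot all_order all_algebra.
From mathcomp Require Import complex reals trigo.
From mathcomp Require Import ring lra.
Set Implicit Arguments.
Unset Strict Implicit.
Unset Printing Implicit Defensive.
Import Order.TTheory GRing.Theory Num.Theory.
Local Open Scope ring_scope.

(** * Bounded sequences *)

Definition bounded_seq {K : numDomainType} (u : nat -> K) : Prop :=
  exists M : K, forall k, `|u k| <= M.

Section BoundedSeq.
Variable K : numDomainType.
Implicit Types u v : nat -> K.

Lemma eq_bounded_seq u v : u =1 v -> bounded_seq u -> bounded_seq v.
Proof. by move=> uv [M uM]; exists M => k; rewrite -uv. Qed.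

Lemma bounded_seq_const u : (forall k, u k.+1 = u k) -> bounded_seq u.
Proof. by move=> uS; exists `|u 0%N|; elim=> [|k]; rewrite ?uS. Qed.

Lemma bounded_seqD u v :
  bounded_seq u -> bounded_seq v -> bounded_seq (fun k => u k + v k).
Proof.
move=> [M uM] [N vN]; exists (M + N) => k.
by rewrite (le_trans (ler_normD _ _)) ?lerD.
Qed.

Lemma bounded_seqZ c u : bounded_seq u -> bounded_seq (fun k => c * u k).
Proof.
move=> [M uM]; exists (`|c| * M) => k.
by rewrite normrM ler_wpM2l.
Qed.

Lemma bounded_seq_contract u c :
  `|c| <= 1 -> (forall k, u k.+1 = c * u k) -> bounded_seq u.
Proof.
move=> c1 uS; exists `|u 0%N|; elim=> // k; apply: le_trans.
by rewrite uS normrM ler_piMl.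
Qed.

End BoundedSeq.

(** * Lyapunov bounds for the real recurrences *)

Section RealRecurrences.
Variable R : realFieldType.
Implicit Types (u V b e d : nat -> R).

Lemma bounded_seq_lyapunov u V c :
    0 < c -> (forall k, c * u k ^+ 2 <= V k) -> (forall k, V k.+1 <= V k) ->
  bounded_seq u.
Proof.
(* The bound rests on [|x| <= 1 + x ^+ 2], which avoids a square root. *)
move=> c0 uV VS; exists (1 + V 0%N / c) => k.
have VkV0 : V k <= V 0%N by elim: k => // k; apply: le_trans.
have : u k ^+ 2 <= V 0%N / c.
  by rewrite ler_pdivlMr // mulrC (le_trans (uV k)).
by rewrite ler_norml => h; apply/andP; split; nra.
Qed.

(** With [d] frozen, the distance from [e] to its equilibrium [delta / a * d] shrinks by the factor
    [(1 - a) / (1 + a)]. *)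
Lemma debye_relaxation_bounded a delta e d :
    0 < a -> (forall k, d k.+1 = d k) ->
    (forall k, (1 + a) * e k.+1 =
       (1 - a) * e k + (1 + delta) * d k.+1 - (1 - delta) * d k) ->
  bounded_seq e.
Proof.
move=> a0 dS eS.
pose x k := e k - delta / a * d k.
have a0' : a != 0 by rewrite gt_eqF.
have a1 : 0 < 1 + a by lra.
have a1' : 1 + a != 0 by rewrite gt_eqF.
apply: (@eq_bounded_seq _ (fun k => x k + delta / a * d k)).
  by move=> k; rewrite subrK.
apply: bounded_seqD; last by apply/bounded_seqZ/bounded_seq_const.
apply: (@bounded_seq_contract _ _ ((1 - a) / (1 + a))).
  rewrite normrM normfV (gtr0_norm a1) ler_pdivrMr // ler_norml.
  by apply/andP; split; lra.
move=> k; rewrite /x.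
have -> : e k.+1 = ((1 - a) * e k + (1 + delta) * d k - (1 - delta) * d k)
                     / (1 + a).
  by apply: (mulfI a1'); rewrite eS dS mulrCA divff // mulr1.
by rewrite dS; field; rewrite a0' a1'.
Qed.

Section Coupled.
Variables (q a delta : R) (b e d : nat -> R).
Hypotheses (q0 : 0 < q) (q4 : q <= 4) (delta0 : 0 < delta).
Hypotheses (bS : forall k, b k.+1 = b k - q * e k)
  (dS : forall k, d k.+1 = d k + b k.+1)
  (eS : forall k, (1 + a) * e k.+1 =
     (1 - a) * e k + (1 + delta) * d k.+1 - (1 - delta) * d k).

Let p k := d k - e k.
Let Dp k := p k.+1 - p k.

Let pS k : p k.+1 = p k + Dp k.
Proof. by rewrite /Dp; ring. Qed.

Let eS' k : e k.+1 = e k + b k - q * e k - Dp k.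
Proof. by rewrite /Dp /p dS bS; ring. Qed.

(** The Debye law in the coordinates [b], [e], [p]: it becomes one linear relation, and every energy
    balance below is an identity modulo it. *)
Let DpE k : (a - delta) * (e k.+1 + e k) = Dp k + delta * (2 * p k + Dp k).
Proof. by have := eS k; rewrite /Dp /p; lra. Qed.

Let mul_sqr_ge0 c (x : R) : 0 < c -> 0 <= c * x ^+ 2.
Proof. by move=> c0; rewrite mulr_ge0 ?sqr_ge0 // ltW. Qed.

Let bounded_d : bounded_seq e -> bounded_seq p -> bounded_seq d.
Proof.
move=> be bp; apply: eq_bounded_seq (bounded_seqD bp be) => k.
exact: subrK.
Qed.

(** Completing the square in [y] shows that the Yee energy is definite exactly while [q (1 - q / 4)]
    is positive. *)
Lemma yee_energyE (x y : R) :
  q * x ^+ 2 - q * y * x + y ^+ 2 = (y - q / 2 * x) ^+ 2 + q * (1 - q / 4) * x ^+ 2.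
Proof. by field. Qed.

(* The staggered Yee energy [e^2 - b e + b^2/q] plus the polarisation energy of
   [p = d - e], multiplied by [q (a - delta)]. *)
Let coupled_lt4 : delta < a -> q < 4 ->
  [/\ bounded_seq b, bounded_seq e & bounded_seq d].
Proof.
move=> da q4'.
pose V k := (a - delta) * (q * e k ^+ 2 - q * b k * e k + b k ^+ 2)
            + delta * q * p k ^+ 2.
have VS k : V k.+1 <= V k.
  have -> : V k.+1 = V k - q * Dp k ^+ 2 - q * Dp k *
      ((a - delta) * (e k.+1 + e k) - (Dp k + delta * (2 * p k + Dp k))).
    by rewrite /V pS eS' bS; ring.
  by rewrite DpE subrr mulr0 subr0 gerBl mul_sqr_ge0.
have da0 : 0 < a - delta by rewrite subr_gt0.
have dq0 : 0 < delta * q by rewrite mulr_gt0.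
have qq0 : 0 < q * (1 - q / 4) by rewrite mulr_gt0 //; lra.
have be : bounded_seq e.
  apply: (@bounded_seq_lyapunov _ V ((a - delta) * (q * (1 - q / 4)))) => //.
    by rewrite mulr_gt0.
  move=> k; rewrite /V yee_energyE [(a - delta) * (_ + _)]mulrDr [leRHS]addrAC -[leLHS]mulrA.
  rewrite lerDr.
  by rewrite addr_ge0 ?mul_sqr_ge0.
have bp : bounded_seq p.
  apply: (@bounded_seq_lyapunov _ V (delta * q)) => // k.
  rewrite /V yee_energyE lerDr mulr_ge0 ?(ltW da0) //.
  by rewrite addr_ge0 ?sqr_ge0 ?mul_sqr_ge0.
have bb : bounded_seq (fun k => b k - q / 2 * e k).
  apply: (@bounded_seq_lyapunov _ V (a - delta)) => // k.
  rewrite /V yee_energyE [(a - delta) * (_ + _)]mulrDr -addrA lerDl.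
  by apply: addr_ge0; rewrite ?mul_sqr_ge0 // mulr_ge0 ?(ltW da0) ?mul_sqr_ge0.
split; [|exact: be|exact: bounded_d].
apply: eq_bounded_seq (bounded_seqD bb (bounded_seqZ (q / 2) be)) => k.
exact: subrK.
Qed.

(* Here [p] is multiplied by [1 - m] at each step; subtracting the component on
   the corresponding eigenvector leaves the undamped Yee recurrence. *)
Let coupled_undamped : a = delta -> q < 4 ->
  [/\ bounded_seq b, bounded_seq e & bounded_seq d].
Proof.
move=> ad q4'.
(* For [a = delta] the left side of [DpE] vanishes, leaving
   [(1 + delta) * Dp k = - 2 * delta * p k]. *)
pose m := 2 * delta / (1 + delta).
have d1 : 0 < 1 + delta by rewrite addr_gt0.
have d1' : 1 + delta != 0 by rewrite gt_eqF.
have m0 : 0 < m by rewrite divr_gt0 // mulr_gt0.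
have m2 : m <= 2 by rewrite ler_pdivrMr //; lra.
have m0' : m != 0 by rewrite gt_eqF.
have DpE' k : Dp k = - m * p k.
  have := DpE k; rewrite ad subrr mul0r => h.
  apply: (mulfI d1'); rewrite /m.
  have -> : (1 + delta) * Dp k = - 2 * delta * p k by lra.
  by field.
have bp : bounded_seq p.
  apply: (@bounded_seq_contract _ _ (1 - m)).
    by rewrite ler_norml; apply/andP; split; lra.
  by move=> k; rewrite pS DpE'; ring.
(* This is the characteristic polynomial of the Yee recurrence at [1 - m]; being nonzero, it makes
   the eigenvector equations solvable. *)
have D0 : 0 < m ^+ 2 - q * m + q.
  have -> : m ^+ 2 - q * m + q = (m - q / 2) ^+ 2 + q * (1 - q / 4) by field.
  rewrite ltr_wpDl ?sqr_ge0 // mulr_gt0 //; lra.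
have D0' : m ^+ 2 - q * m + q != 0 by rewrite gt_eqF.
(* [(k1, k2, 1)] is the eigenvector in the coordinates [(e, b, p)] for the eigenvalue [1 - m]. *)
pose k1 := - m ^+ 2 / (m ^+ 2 - q * m + q).
pose k2 := q * k1 / m.
pose e' k := e k - k1 * p k.
pose b' k := b k - k2 * p k.
have b'S k : b' k.+1 = b' k - q * e' k.
  rewrite /b' /e' pS DpE' bS /k2; field; exact: m0'.
have e'S k : e' k.+1 = e' k + b' k - q * e' k.
  rewrite /b' /e' pS eS' DpE' /k2 /k1; field.
  by rewrite m0' D0'.
pose V k := q * e' k ^+ 2 - q * b' k * e' k + b' k ^+ 2.
have VS k : V k.+1 <= V k.
  (* Without damping the energy is conserved exactly. *)
  by rewrite le_eqVlt; apply/orP; left; apply/eqP; rewrite /V e'S b'S; ring.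
have qq0 : 0 < q * (1 - q / 4) by rewrite mulr_gt0 //; lra.
have be' : bounded_seq e'.
  apply: (@bounded_seq_lyapunov _ V (q * (1 - q / 4))) => // k.
  by rewrite /V yee_energyE lerDr sqr_ge0.
have bb' : bounded_seq (fun k => b' k - q / 2 * e' k).
  apply: (@bounded_seq_lyapunov _ V 1) => // k.
  by rewrite /V yee_energyE mul1r lerDl mul_sqr_ge0.
have be : bounded_seq e.
  apply: eq_bounded_seq (bounded_seqD be' (bounded_seqZ k1 bp)) => k.
  exact: subrK.
split; [|exact: be|exact: bounded_d].
apply: eq_bounded_seq (bounded_seqD (bounded_seqD bb'
  (bounded_seqZ (q / 2) be')) (bounded_seqZ k2 bp)) => k.
by rewrite subrK /b' subrK.
Qed.

(* At [q = 4] the energy only controls [s = e - b / 2] and [p]; the missing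
   coordinate is the one along the left eigenvector for the eigenvalue [-1]. *)
Let coupled_eq4 : delta < a -> q = 4 ->
  [/\ bounded_seq b, bounded_seq e & bounded_seq d].
Proof.
move=> da qE; pose al := a - delta.
have al0 : 0 < al by rewrite subr_gt0.
have al0' : al != 0 by rewrite gt_eqF.
pose s k := e k - b k / 2.
have eE k : e k = s k + b k / 2 by rewrite subrK.
have bS' k : b k.+1 = - b k - 4 * s k by rewrite bS qE /s; field.
have sS k : s k.+1 = - s k - Dp k by rewrite /s eS' bS qE; field.
have DpE' k : al * (- Dp k - 2 * s k) = Dp k + delta * (2 * p k + Dp k).
  by rewrite -DpE -/al (eE k.+1) sS bS' eE; field.
pose V k := al * s k ^+ 2 + delta * p k ^+ 2.
have VS k : V k.+1 <= V k.
  have -> : V k.+1 = V k - Dp k ^+ 2 - Dp k *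
      (al * (- Dp k - 2 * s k) - (Dp k + delta * (2 * p k + Dp k))).
    by rewrite /V pS sS; ring.
  by rewrite DpE' subrr mulr0 subr0 gerBl sqr_ge0.
have bs : bounded_seq s.
  apply: (@bounded_seq_lyapunov _ V al) => // k.
  by rewrite /V lerDl mul_sqr_ge0.
have bp : bounded_seq p.
  apply: (@bounded_seq_lyapunov _ V delta) => // k.
  by rewrite /V lerDr mul_sqr_ge0.
(* Chosen so that the sum of two successive values of [b + k1 s + k2 p] is [2 / al] times the
   relation [DpE'], hence zero. *)
pose k1 := 2 * (1 + al) / al; pose k2 := - 2 * delta / al.
have bc : bounded_seq (fun k => b k + k1 * s k + k2 * p k).
  apply: (@bounded_seq_contract _ _ (- 1)); first by rewrite normrN1.
  move=> k; apply/eqP; rewrite -subr_eq0; apply/eqP.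
  have -> : b k.+1 + k1 * s k.+1 + k2 * p k.+1
      - -1 * (b k + k1 * s k + k2 * p k) =
      2 / al * (al * (- Dp k - 2 * s k) - (Dp k + delta * (2 * p k + Dp k))).
    by rewrite bS' sS pS /k1 /k2; field; exact: al0'.
  by rewrite DpE' subrr mulr0.
have bb : bounded_seq b.
  apply: eq_bounded_seq (bounded_seqD bc (bounded_seqD
    (bounded_seqZ (- k1) bs) (bounded_seqZ (- k2) bp))) => k.
  by ring.
have be : bounded_seq e.
  by apply: eq_bounded_seq (bounded_seqD bs (bounded_seqZ 2^-1 bb)) => k;
    rewrite eE mulrC.
by split=> //; exact: bounded_d.
Qed.

(** The disjunction rules out [a = delta] with [q = 4], where the Yee recurrence has a Jordan block
    at [-1] and grows linearly. *)
Lemma yee_debye_bounded : delta <= a -> delta < a \/ q < 4 ->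
  [/\ bounded_seq b, bounded_seq e & bounded_seq d].
Proof.
rewrite le_eqVlt => /predU1P[da|da _].
  by case=> [|q4']; [rewrite da ltxx|exact: coupled_undamped].
have /predU1P[q4'|q4'] : (q == 4) || (q < 4) by rewrite -le_eqVlt.
  exact: coupled_eq4.
exact: coupled_lt4.
Qed.

End Coupled.
End RealRecurrences.

(** * From real to complex amplitudes *)

Section ComplexRecurrences.
Variable R : realType.
Implicit Types (q delta epsp : R).
Local Open Scope complex_scope.

Lemma complex_bounded_seq (u : nat -> R[i]) :
    bounded_seq (fun k => complex.Re (u k)) ->
    bounded_seq (fun k => complex.Im (u k)) ->
  bounded_seq u.
Proof.
move=> bre bim.
have bC (v : nat -> R) : bounded_seq v -> bounded_seq (fun k => (v k)%:C).
  move=> [M vM]; exists M%:C => k.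
  by rewrite normc_def /= expr0n addr0 sqrtr_sqr lecR.
apply: eq_bounded_seq (bounded_seqD (bC _ bre) (bounded_seqZ 'i (bC _ bim))).
by move=> k; rewrite -complexE.
Qed.

(** Carries the Debye law over to transverse and longitudinal combinations of the electric
    components. *)
Lemma debye_step_comb delta epsp (x y e d d' f h h' : R[i]) :
  debye_step delta epsp (x * e + y * f) (x * d + y * h) (x * d' + y * h') =
  x * debye_step delta epsp e d d' + y * debye_step delta epsp f h h'.
Proof. by rewrite /debye_step; ring. Qed.

Lemma mulc_Re r (z : R[i]) : complex.Re (r%:C * z) = r * complex.Re z.
Proof. by case: z => x y; rewrite /= mul0r subr0. Qed.

Lemma mulc_Im r (z : R[i]) : complex.Im (r%:C * z) = r * complex.Im z.
Proof. by case: z => x y; rewrite /= mul0r addr0. Qed.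

Lemma debye_step_Re delta epsp (e d d' : R[i]) : 1 + delta * epsp != 0 ->
  (1 + delta * epsp) * complex.Re (debye_step delta epsp e d d') =
  (1 - delta * epsp) * complex.Re e + (1 + delta) * complex.Re d'
    - (1 - delta) * complex.Re d.
Proof.
move=> nz; rewrite -mulc_Re /debye_step mulrCA divff ?mulr1.
  by rewrite -!mulc_Re !raddfB !raddfD.
by rewrite -(rmorph0 (real_complex R)) (inj_eq (@complexI R)).
Qed.

Lemma debye_step_Im delta epsp (e d d' : R[i]) : 1 + delta * epsp != 0 ->
  (1 + delta * epsp) * complex.Im (debye_step delta epsp e d d') =
  (1 - delta * epsp) * complex.Im e + (1 + delta) * complex.Im d'
    - (1 - delta) * complex.Im d.
Proof.
move=> nz; rewrite -mulc_Im /debye_step mulrCA divff ?mulr1.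
  by rewrite -!mulc_Im !raddfB !raddfD.
by rewrite -(rmorph0 (real_complex R)) (inj_eq (@complexI R)).
Qed.

Section Fixed.
Variables (delta epsp : R).
Hypotheses (delta0 : 0 < delta) (epsp1 : 1 <= epsp).

Let a0 : 0 < delta * epsp.
Proof. by rewrite mulr_gt0 // (lt_le_trans ltr01). Qed.

Let a1 : 1 + delta * epsp != 0.
Proof. by rewrite gt_eqF // addr_gt0. Qed.

Lemma complex_debye_relaxation_bounded (e d : nat -> R[i]) :
    (forall k, d k.+1 = d k) ->
    (forall k, e k.+1 = debye_step delta epsp (e k) (d k) (d k.+1)) ->
  bounded_seq e.
Proof.
move=> dS eS; apply: complex_bounded_seq.
  apply: (debye_relaxation_bounded (d := fun k => complex.Re (d k)) a0) => k.
    by rewrite dS.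
  by rewrite eS debye_step_Re.
apply: (debye_relaxation_bounded (d := fun k => complex.Im (d k)) a0) => k.
  by rewrite dS.
by rewrite eS debye_step_Im.
Qed.

(** All coefficients are real, so real and imaginary parts obey the real recurrence separately, with
    [a = delta * epsp]. *)
Lemma complex_yee_debye_bounded q (b e d : nat -> R[i]) :
    0 < q -> q <= 4 -> 1 < epsp \/ q < 4 ->
    (forall k, b k.+1 = b k - q%:C * e k) ->
    (forall k, d k.+1 = d k + b k.+1) ->
    (forall k, e k.+1 = debye_step delta epsp (e k) (d k) (d k.+1)) ->
  [/\ bounded_seq b, bounded_seq e & bounded_seq d].
Proof.
move=> q0 q4 hq bS dS eS.
have da : delta <= delta * epsp by rewrite ler_pMr.
have hq' : delta < delta * epsp \/ q < 4 by rewrite ltr_pMr.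
have [br er dr] : [/\ bounded_seq (fun k => complex.Re (b k)),
    bounded_seq (fun k => complex.Re (e k)) &
    bounded_seq (fun k => complex.Re (d k))].
  apply: (yee_debye_bounded q0 q4 delta0) da hq' => k.
  - by rewrite bS raddfB /= mulc_Re.
  - by rewrite dS raddfD.
  - by rewrite eS debye_step_Re.
have [bi ei di] : [/\ bounded_seq (fun k => complex.Im (b k)),
    bounded_seq (fun k => complex.Im (e k)) &
    bounded_seq (fun k => complex.Im (d k))].
  apply: (yee_debye_bounded q0 q4 delta0) da hq' => k.
  - by rewrite bS raddfB /= mulc_Im.
  - by rewrite dS raddfD.
  - by rewrite eS debye_step_Im.
by split; apply: complex_bounded_seq.
Qed.

(** * Decoupling the two polarisations *)

Variables (sx sy : R[i]) (q : R).
Hypotheses (qE : q%:C = sx * sx^* + sy * sy^*) (q4 : q <= 4)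
  (hq : 1 < epsp \/ q < 4).

Let q_ge0 : 0 <= q.
Proof. by rewrite -(@lecR R) qE addr_ge0 ?mul_conjC_ge0. Qed.

Let s0 : q = 0 -> sx = 0 /\ sy = 0.
Proof.
move=> q0; have /esym/eqP := qE; rewrite q0 paddr_eq0 ?mul_conjC_ge0 //.
by rewrite !mul_conjC_eq0 => /andP[/eqP-> /eqP->].
Qed.

Let qC0 : q != 0 -> sx * sx^* + sy * sy^* != 0.
Proof.
by move=> q0; rewrite -qE -(rmorph0 (real_complex R)) (inj_eq (@complexI R)).
Qed.

(* Besides the transverse part of [(bx, by)], driven by [e], there is the
   discrete divergence [sx * bx + sy * by], which is conserved. *)
Lemma BxByEz_bounded (bx by_ e d : nat -> R[i]) :
    (forall k, bx k.+1 = bx k - sy * e k) ->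
    (forall k, by_ k.+1 = by_ k + sx * e k) ->
    (forall k, d k.+1 = d k + (sy^* * bx k.+1 - sx^* * by_ k.+1)) ->
    (forall k, e k.+1 = debye_step delta epsp (e k) (d k) (d k.+1)) ->
  [/\ bounded_seq bx, bounded_seq by_, bounded_seq e & bounded_seq d].
Proof.
move=> bxS byS dS eS; have [q0|q0] := eqVneq q 0.
  have [sx0 sy0] := s0 q0.
  have dS' k : d k.+1 = d k by rewrite dS sx0 sy0 !conjC0 !mul0r subr0 addr0.
  split; last exact: bounded_seq_const.
  - by apply: bounded_seq_const => k; rewrite bxS sy0 mul0r subr0.
  - by apply: bounded_seq_const => k; rewrite byS sx0 mul0r addr0.
  - exact: complex_debye_relaxation_bounded eS.
have q_gt0 : 0 < q by rewrite lt_neqAle eq_sym q0.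
pose b k := sy^* * bx k - sx^* * by_ k.
pose w k := sx * bx k + sy * by_ k.
have bS k : b k.+1 = b k - q%:C * e k by rewrite /b bxS byS qE; ring.
have bw : bounded_seq w.
  by apply: bounded_seq_const => k; rewrite /w bxS byS; ring.
have [bb be bd] := complex_yee_debye_bounded q_gt0 q4 hq bS dS eS.
have nz := qC0 q0; split=> //.
  (* The map from [(bx, by_)] to [(b, w)] has determinant [q], so it is inverted here. *)
  apply: eq_bounded_seq (bounded_seqD (bounded_seqZ (sy / q%:C) bb)
    (bounded_seqZ (sx^* / q%:C) bw)) => k.
  by rewrite /b /w qE; field.
apply: eq_bounded_seq (bounded_seqD (bounded_seqZ (- sx / q%:C) bb)
  (bounded_seqZ (sy^* / q%:C) bw)) => k.
by rewrite /b /w qE; field.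
Qed.

(* The transverse part of the electric field couples to [b] as above; its
   longitudinal part relaxes towards a constant multiple of the conserved
   divergence of [d]. *)
Lemma BzExEy_bounded (b ex dx ey dy : nat -> R[i]) :
    (forall k, b k.+1 = b k + sy * ex k - sx * ey k) ->
    (forall k, dx k.+1 = dx k + - sy^* * b k.+1) ->
    (forall k, dy k.+1 = dy k + sx^* * b k.+1) ->
    (forall k, ex k.+1 = debye_step delta epsp (ex k) (dx k) (dx k.+1)) ->
    (forall k, ey k.+1 = debye_step delta epsp (ey k) (dy k) (dy k.+1)) ->
  [/\ bounded_seq b, bounded_seq ex, bounded_seq dx, bounded_seq ey
    & bounded_seq dy].
Proof.
move=> bS dxS dyS exS eyS; have [q0|q0] := eqVneq q 0.
  have [sx0 sy0] := s0 q0.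
  have dxS' k : dx k.+1 = dx k by rewrite dxS sy0 conjC0 oppr0 mul0r addr0.
  have dyS' k : dy k.+1 = dy k by rewrite dyS sx0 conjC0 mul0r addr0.
  split; [|exact: complex_debye_relaxation_bounded exS
    |exact: bounded_seq_const|exact: complex_debye_relaxation_bounded eyS
    |exact: bounded_seq_const].
  by apply: bounded_seq_const => k; rewrite bS sx0 sy0 !mul0r subr0 addr0.
have q_gt0 : 0 < q by rewrite lt_neqAle eq_sym q0.
have nz := qC0 q0.
pose et k := - sy * ex k + sx * ey k.
pose dt k := - sy * dx k + sx * dy k.
pose el k := sx^* * ex k + sy^* * ey k.
pose dl k := sx^* * dx k + sy^* * dy k.
have etS k : et k.+1 = debye_step delta epsp (et k) (dt k) (dt k.+1).
  by rewrite /et /dt debye_step_comb exS eyS.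
have elS k : el k.+1 = debye_step delta epsp (el k) (dl k) (dl k.+1).
  by rewrite /el /dl debye_step_comb exS eyS.
have dlS k : dl k.+1 = dl k by rewrite /dl dxS dyS; ring.
have bel : bounded_seq el by apply: complex_debye_relaxation_bounded elS.
have bdl : bounded_seq dl by apply: bounded_seq_const.
(* Rescaling the magnetic amplitude by [q] gives the normal form of the coupled recurrence, with
   [et] and [dt] as electric amplitude and displacement. *)
have qbS k : q%:C * b k.+1 = q%:C * b k - q%:C * et k.
  by rewrite bS /et; ring.
have dtS k : dt k.+1 = dt k + q%:C * b k.+1 by rewrite /dt dxS dyS qE; ring.
have [bb bet bdt] := complex_yee_debye_bounded (b := fun k => q%:C * b k)
  q_gt0 q4 hq qbS dtS etS.
have nz' : q%:C != 0 by rewrite qE.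
split.
- apply: eq_bounded_seq (bounded_seqZ (q%:C)^-1 bb) => k.
  by rewrite mulKf.
- apply: eq_bounded_seq (bounded_seqD (bounded_seqZ (- sy^* / q%:C) bet)
    (bounded_seqZ (sx / q%:C) bel)) => k.
  by rewrite /et /el qE; field.
- apply: eq_bounded_seq (bounded_seqD (bounded_seqZ (- sy^* / q%:C) bdt)
    (bounded_seqZ (sx / q%:C) bdl)) => k.
  by rewrite /dt /dl qE; field.
- apply: eq_bounded_seq (bounded_seqD (bounded_seqZ (sx^* / q%:C) bet)
    (bounded_seqZ (sy / q%:C) bel)) => k.
  by rewrite /et /el qE; field.
- apply: eq_bounded_seq (bounded_seqD (bounded_seqZ (sx^* / q%:C) bdt)
    (bounded_seqZ (sy / q%:C) bdl)) => k.
  by rewrite /dt /dl qE; field.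
Qed.

End Fixed.

(** * From bounded orbits to stability *)

Lemma bounded_powers n (f : 'cV[R[i]]_n.+1 -> 'cV[R[i]]_n.+1) :
    linear f ->
    (forall U i, bounded_seq (fun k => iter k f U i 0)) ->
  exists M : R, forall k (i j : 'I_n.+1),
    `|(matrix_of_map f ^+ k) i j| <= M%:C.
Proof.
move=> lf bf.
have powE k U : matrix_of_map f ^+ k *m U = iter k f U.
  elim: k => [|k IHk]; first by rewrite mul1mx.
  by rewrite exprS -mulmxE -mulmxA IHk matrix_of_mapP.
have /fin_all_exists[M MP] (ij : 'I_n.+1 * 'I_n.+1) :
    exists M : R, forall k, `|(matrix_of_map f ^+ k) ij.1 ij.2| <= M%:C.
  have [M MP] := bf (delta_mx ij.2 0) ij.1.
  have M0 : 0 <= M by apply: le_trans (MP 0%N).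
  (* The bound [M] lives in [R[i]], but a nonnegative element there is real. *)
  exists (complex.Re M) => k; rewrite RRe_real ?ger0_real //.
  by have := MP k; rewrite -powE -colE mxE.
(* Summing the bounds of the finitely many entries gives a uniform one. *)
exists (\sum_ij `|M ij|) => k i j; apply: le_trans (MP (i, j) k) _.
rewrite lecR (bigD1 (i, j)) //= ler_wpDr ?ler_norm //.
by rewrite sumr_ge0.
Qed.

(** The squared modulus is [2 * lambda ^+ 2 * (1 - cos t)], largest at [cos t = -1]. *)
Lemma sigma_mulJ_le (lambda t : R) :
  exists2 r, sigma lambda t * (sigma lambda t)^* = r%:C & r <= 4 * lambda ^+ 2.
Proof.
exists (2 * lambda ^+ 2 * (1 - cos t)).
  rewrite /sigma /cexpi; simpc.
  congr (_ +i* _); last by ring.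
  transitivity (lambda ^+ 2 * (cos t ^+ 2 + sin t ^+ 2 + 1 - 2 * cos t)).
    by ring.
  by rewrite cos2Dsin2; ring.
have := cos_geN1 t; have := sqr_ge0 lambda; nra.
Qed.

Section Stability.
Variables lambda delta epsp : R.
Hypotheses (delta0 : 0 < delta) (epsp1 : 1 <= epsp)
  (cfl : 2 * lambda ^+ 2 <= 1) (strict : 1 < epsp \/ 2 * lambda ^+ 2 < 1).

(** Each direction contributes at most [4 * lambda ^+ 2], so the condition on [lambda] turns into
    [q <= 4], strictly when [cfl] is strict. *)
Let qP xi_x xi_y : exists q : R, [/\
  q%:C = sigma lambda xi_x * (sigma lambda xi_x)^* +
         sigma lambda xi_y * (sigma lambda xi_y)^*,
  q <= 4 & 1 < epsp \/ q < 4].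
Proof.
have [rx rxE rx4] := sigma_mulJ_le lambda xi_x.
have [ry ryE ry4] := sigma_mulJ_le lambda xi_y.
exists (rx + ry); rewrite rxE ryE rmorphD; split=> //.
  by have := cfl; lra.
by case: strict => ?; [left|right; lra].
Qed.

Lemma step_BxByEz_stable xi_x xi_y : exists M : R, forall k i j,
  `|(matrix_of_map (step_BxByEz lambda delta epsp xi_x xi_y) ^+ k) i j|
    <= M%:C.
Proof.
have [q [qE q4 hq]] := qP xi_x xi_y.
apply: bounded_powers; first exact: step_BxByEz_linear.
move=> U; pose u k := iter k (step_BxByEz lambda delta epsp xi_x xi_y) U.
have [||||b0 b1 b2 b3] := BxByEz_bounded delta0 epsp1 qE q4 hq
  (bx := fun k => u k 0 0) (by_ := fun k => u k 1 0)
  (e := fun k => u k 2%:R 0) (d := fun k => u k 3%:R 0).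
1-4: by move=> k; rewrite /u /= !mxE.
by move=> i; case: i => -[|[|[|[|//]]]] lt4; [move: b0|move: b1|move: b2|move: b3];
  apply: eq_bounded_seq => k; congr (u k _ _); apply: val_inj.
Qed.

Lemma step_BzExEy_stable xi_x xi_y : exists M : R, forall k i j,
  `|(matrix_of_map (step_BzExEy lambda delta epsp xi_x xi_y) ^+ k) i j|
    <= M%:C.
Proof.
have [q [qE q4 hq]] := qP xi_x xi_y.
apply: bounded_powers; first exact: step_BzExEy_linear.
move=> U; pose u k := iter k (step_BzExEy lambda delta epsp xi_x xi_y) U.
have [|||||b0 b1 b2 b3 b4] := BzExEy_bounded delta0 epsp1 qE q4 hq
  (b := fun k => u k 0 0) (ex := fun k => u k 1 0)
  (dx := fun k => u k 2%:R 0) (ey := fun k => u k 3%:R 0)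
  (dy := fun k => u k 4%:R 0).
1-5: by move=> k; rewrite /u /= !mxE.
by move=> i; case: i => -[|[|[|[|[|//]]]]] lt4;
  [move: b0|move: b1|move: b2|move: b3|move: b4];
  apply: eq_bounded_seq => k; congr (u k _ _); apply: val_inj.
Qed.

End Stability.
End ComplexRecurrences.

Theorem mainTheorem9 (R : realType) (c_inf eps_inf eps_s t_r dx dt : R)
    (hc : 0 < c_inf) (heps : 0 < eps_inf) (htr : 0 < t_r)
    (hdx : 0 < dx) (hdt : 0 < dt) (hs : eps_inf <= eps_s) :
  (eps_inf < eps_s -> dt <= dx / (Num.sqrt 2 * c_inf) ->
     von_neumann_stable (amplification_BxByEz c_inf eps_inf eps_s t_r dx dt) /\
     von_neumann_stable (amplification_BzExEy c_inf eps_inf eps_s t_r dx dt)) /\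
  (eps_s = eps_inf -> dt < dx / (Num.sqrt 2 * c_inf) ->
     von_neumann_stable (amplification_BxByEz c_inf eps_inf eps_s t_r dx dt) /\
     von_neumann_stable (amplification_BzExEy c_inf eps_inf eps_s t_r dx dt)).
Proof.
have delta0 : 0 < dt / (2 * t_r) by rewrite divr_gt0 ?mulr_gt0.
have epsp1 : 1 <= eps_s / eps_inf by rewrite ler_pdivlMr ?mul1r.
have lambda0 : 0 < c_inf * dt / dx by rewrite divr_gt0 ?mulr_gt0.
have s20 : 0 < Num.sqrt 2 :> R by rewrite sqrtr_gt0.
(* The time step restriction reads [Num.sqrt 2 * lambda <= 1]; both sides are nonnegative, so it may
   be squared. *)
have lambdaE : 2 * (c_inf * dt / dx) ^+ 2 = (Num.sqrt 2 * (c_inf * dt / dx)) ^+ 2.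
  by rewrite [RHS]exprMn sqr_sqrtr.
have s2lambdaE : Num.sqrt 2 * (c_inf * dt / dx) = dt * (Num.sqrt 2 * c_inf) / dx.
  by ring.
have nn : 0 <= Num.sqrt 2 * (c_inf * dt / dx) by exact/ltW/mulr_gt0.
split=> [hs' cfl|_ cfl].
  have epsp1' : 1 < eps_s / eps_inf by rewrite ltr_pdivlMr ?mul1r.
  have cfl' : 2 * (c_inf * dt / dx) ^+ 2 <= 1.
    rewrite lambdaE expr_le1 ?nn //.
    by rewrite s2lambdaE ler_pdivrMr // mul1r -ler_pdivlMr // mulr_gt0.
  split=> xi_x xi_y; [apply: step_BxByEz_stable|apply: step_BzExEy_stable] => //;
    by left.
have cfl' : 2 * (c_inf * dt / dx) ^+ 2 < 1.
  rewrite lambdaE expr_lt1 ?nn //.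
  by rewrite s2lambdaE ltr_pdivrMr // mul1r -ltr_pdivlMr // mulr_gt0.
split=> xi_x xi_y; [apply: step_BxByEz_stable|apply: step_BzExEy_stable] => //;
  by [exact: ltW|right].
Qed.
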